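(* For $N\ge1$ and $\lambda\ge0$, set $$x_n=\lambda n^{-3/2}\mathbf 1_{\{1\le n\le N\}}.$$ Then $$\mathcal C(x)<2AE_3\qquad(\lambda>0),$$ and, with $H_M^{(s)}=\sum_{n=1}^Mn^{-s}$ and $H_0^{(s)}=0$, $$2AE_3-\mathcal C(x)\ge\lambda^3\left[\frac2{\sqrt N}+2H_{N-1}^{(1/2)}-\sqrt2\sum_{c=2}^N\frac1{\sqrt c}\right]>0.$$ Moreover, $$\lim_{N\to\infty}\frac{\mathcal C(x)}{AE_3}=2.$$ The same conclusions hold after dilating the support from $\{1,\ldots,N\}$ to $\{q,2q,\ldots,Nq\}$, $q\in\mathbb N$ (i.e. for the sequence $x'$ with $x'_{qn}=x_n$ for $n\ge1$ and $x'_k=0$ when $q\nmid k$). Consequently, the constant $2$ in the inequality $\mathcal C(x)\le2AE_3$ is sharp even within finite critical plateaux (the sequences $x$ above), although equality is attained only in the escaping infinite-cutoff limit $N\to\infty$.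
   Context: For a nonnegative sequence $x=(x_n)_{n\ge1}$, $$A=\sum_{n\ge1}x_n,\qquad E_3=\sum_{n\ge1}n^3x_n^2,\qquad \mathcal C(x)=\sum_{a,b\ge1}(a+b)(a^2+ab+b^2)x_ax_bx_{a+b}.$$ Here $N$ is an integer. *)

(* Defs.v *)
From mathcomp Require Import all_boot all_order all_algebra.
From mathcomp Require Import all_classical all_reals all_analysis.
Set Implicit Arguments.
Unset Strict Implicit.
Unset Printing Implicit Defensive.
Import Order.TTheory GRing.Theory Num.Theory.
Import numFieldNormedType.Exports.
Local Open Scope ring_scope.

(* A nonnegative sequence (x_n)_{n >= 1} is a function [x : nat -> R] whose
   value at 0 is never used.  The sums are series of nonnegative terms in
   [\bar R], so they are meaningful even when they diverge. *)

Definition total_mass (R : realType) (x : nat -> R) : \bar R :=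
  (\sum_(1 <= n <oo) (x n)%:E)%E.

Definition energy3 (R : realType) (x : nat -> R) : \bar R :=
  (\sum_(1 <= n <oo) (n%:R ^+ 3 * x n ^+ 2)%:E)%E.

Definition cubic_form (R : realType) (x : nat -> R) : \bar R :=
  (\sum_(1 <= a <oo) \sum_(1 <= b <oo)
     ((a%:R + b%:R) * (a%:R ^+ 2 + a%:R * b%:R + b%:R ^+ 2)
      * x a * x b * x (a + b)%N)%:E)%E.

Definition harmonic_sum (R : realType) (s : R) (M : nat) : R :=
  \sum_(1 <= n < M.+1) n%:R `^ (- s).

Definition plateau (R : realType) (N : nat) (lambda : R) : nat -> R :=
  fun n => if (1 <= n <= N)%N then lambda * n%:R `^ (- (3 / 2)) else 0.

Definition dilate (R : realType) (q : nat) (x : nat -> R) : nat -> R :=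
  fun k => if (q %| k)%N then x (k %/ q)%N else 0.

Definition plateau_gap (R : realType) (N : nat) : R :=
  2 / Num.sqrt N%:R + 2 * harmonic_sum 2^-1 N.-1
  - Num.sqrt 2 * \sum_(2 <= c < N.+1) 1 / Num.sqrt c%:R.

(* Main.v *)
Require Import Defs.
From mathcomp Require Import all_boot all_order all_algebra.
From mathcomp Require Import all_classical all_reals all_analysis.
From mathcomp Require Import ring lra zify.
Import Order.TTheory GRing.Theory Num.Theory.
Import numFieldNormedType.Exports.
Local Open Scope classical_set_scope.
Local Open Scope ring_scope.

(** On the plateau of height [lambda] and cutoff [N], [A = lambda H_N] with
    [H_M] the sum of [n^(-3/2)] over [n <= M], [E_3 = lambda^2 N], and the cubic
    form is [lambda^3] times the sum over [a + b <= N] of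
      [T(a,b) = (a^2 + a b + b^2) / ((a b)^(3/2) (a + b)^(1/2))].
    The point is that [T(a,b)] is close to [a^(-3/2) + b^(-3/2)].  Summing the
    latter along the antidiagonals [a + b = c <= N] gives the sum of
    [2 H_(c-1)], and summation by parts turns this into [2 N H_N] up to the
    lower-order term [2 h_N], where [h_N] is the sum of [n^(-1/2)]
    ([harmonic_sum32_split]).  So everything rests on two-sided control of the
    excess [T(a,b) - a^(-3/2) - b^(-3/2)].

    With [u, v, w] the square roots of [a, b, a + b], i.e. [w^2 = u^2 + v^2],
    the excess factors as
      [(w^2 - u v) (w - u) (w - v) / (u^3 v^3 w)]  ([excess_factor]).
    - It is nonnegative, so the cubic sum is at least [2 N H_N - 2 h_N].  Since
      [h_N <= 2 sqrt N] and [H_N >= 1], the ratio is at least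
      [2 - 4 / sqrt N], hence it tends to 2.
    - Because [(w - u) (w - v) (w^2 + u v + w (u + v)) = (u v)^2], it is at
      most [(1/u + 1/v) / (2 w^2) - (3/5) / w^3].  On the antidiagonal
      [a + b = c] these bounds add up to at most [1.4 / sqrt c], which is below
      [sqrt 2 / sqrt c] ([diagonal_le]); that is the stated gap.

    The gap is positive because it equals [2] plus [2 - sqrt 2] times the sum
    of [1 / sqrt c] over [2 <= c <= N].  Dilating by [q] keeps [A] and
    multiplies both [E_3] and the cubic form by [q^3], so ratios are unchanged
    and deficits can only grow.  Finally the ratio depends on [N] alone and is
    below 2 for each [N], so it cannot approach 2 while [N] takes some value
    infinitely often. *)

(** * The excess of the interaction over its main term *)

Lemma hypotenuse_lt (R : realFieldType) (u v w : R) :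
  0 < u -> 0 < v -> 0 < w -> w ^+ 2 = u ^+ 2 + v ^+ 2 -> u < w /\ v < w.
Proof. by move=> u0 v0 w0 E; split; nra. Qed.

(** The left side equals [w^4 - (u v)^2 - w (u + v) (w^2 - u v)], from which
    [w^2 - u v] can be factored out. *)
Lemma excess_factor (R : realFieldType) (u v w : R) :
  w ^+ 2 = u ^+ 2 + v ^+ 2 ->
  u ^+ 4 + u ^+ 2 * v ^+ 2 + v ^+ 4 - w * (u ^+ 3 + v ^+ 3)
  = (w ^+ 2 - u * v) * ((w - u) * (w - v)).
Proof.
move=> E.
have E4 : w ^+ 4 = (u ^+ 2 + v ^+ 2) ^+ 2 by rewrite -E; ring.
have E3 : w ^+ 3 = w * (u ^+ 2 + v ^+ 2) by rewrite -E; ring.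
by ring: E E4 E3.
Qed.

Lemma excess_ge0 (R : realFieldType) (u v w : R) :
  0 < u -> 0 < v -> 0 < w -> w ^+ 2 = u ^+ 2 + v ^+ 2 ->
  (u ^+ 3)^-1 + (v ^+ 3)^-1
  <= (u ^+ 4 + u ^+ 2 * v ^+ 2 + v ^+ 4) / (u ^+ 3 * v ^+ 3 * w).
Proof.
move=> u0 v0 w0 E; have [uw vw] := hypotenuse_lt _ _ _ _ u0 v0 w0 E.
rewrite -subr_ge0.
have -> : (u ^+ 4 + u ^+ 2 * v ^+ 2 + v ^+ 4) / (u ^+ 3 * v ^+ 3 * w)
          - ((u ^+ 3)^-1 + (v ^+ 3)^-1)
    = (u ^+ 4 + u ^+ 2 * v ^+ 2 + v ^+ 4 - w * (u ^+ 3 + v ^+ 3))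
      / (u ^+ 3 * v ^+ 3 * w).
  by field; rewrite !gt_eqF.
rewrite excess_factor// divr_ge0 ?mulr_ge0 ?exprn_ge0 ?subr_ge0// ?ltW//.
by rewrite E; have := sqr_ge0 (u - v); nra.
Qed.

(** Writing [m = u v] and [P = (w - u) (w - v)], the identity
    [P (w^2 + m + w (u + v)) = m^2] together with [w <= u + v] bounds the excess
    by [(w^2 - m) / (m w (2 w^2 + m))], which is
    [1 / (2 m w) - 3 / (2 w (2 w^2 + m))].  The constant [3/5] comes from
    [m <= w^2 / 2]; without this negative term the bound would sum, along the
    antidiagonal [a + b = c], to about [2 / sqrt c] for large [c], which is too
    much. *)
Lemma excess_le (R : realFieldType) (u v w : R) :
  0 < u -> 0 < v -> 0 < w -> w ^+ 2 = u ^+ 2 + v ^+ 2 ->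
  (u ^+ 4 + u ^+ 2 * v ^+ 2 + v ^+ 4) / (u ^+ 3 * v ^+ 3 * w)
  <= (u ^+ 3)^-1 + (v ^+ 3)^-1
     + ((u^-1 + v^-1) / 2 / w ^+ 2 - 3 / 5 / w ^+ 3).
Proof.
move=> u0 v0 w0 E; have [uw vw] := hypotenuse_lt _ _ _ _ u0 v0 w0 E.
have m0 : 0 < u * v by rewrite mulr_gt0.
have mW : 2 * (u * v) <= w ^+ 2 by rewrite E; have := sqr_ge0 (u - v); nra.
have wuv : w <= u + v by nra.
have PE : (w - u) * (w - v) * (w ^+ 2 + u * v + w * (u + v)) = (u * v) ^+ 2.
  have E4 : w ^+ 4 = (u ^+ 2 + v ^+ 2) ^+ 2 by rewrite -E; ring.
  by ring: E E4.
set P := (w - u) * (w - v) in PE.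
have P0 : 0 <= P by rewrite mulr_ge0// subr_ge0 ltW.
have PW : P * (2 * w ^+ 2 + u * v) <= (u * v) ^+ 2.
  rewrite -PE ler_wpM2l//; nra.
(* the claim with denominators cleared and [w (u + v)] weakened to [w^2] *)
have key : w ^+ 2 * ((w ^+ 2 - u * v) * P)
    <= (u * v) ^+ 2 * (w ^+ 2 / 2 - 3 / 5 * (u * v)).
  have W0 : 0 < 2 * w ^+ 2 + u * v by nra.
  rewrite -(ler_pM2r W0).
  apply: (@le_trans _ _ (w ^+ 2 * (w ^+ 2 - u * v) * (u * v) ^+ 2)).
    rewrite -[leLHS]mulrA -[X in _ * X <= _]mulrA -[leRHS]mulrA.
    apply: ler_wpM2l; first exact: sqr_ge0.
    by apply: ler_wpM2l => //; rewrite subr_ge0; lra.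
  rewrite -subr_ge0.
  have -> : (u * v) ^+ 2 * (w ^+ 2 / 2 - 3 / 5 * (u * v)) * (2 * w ^+ 2 + u * v)
      - w ^+ 2 * (w ^+ 2 - u * v) * (u * v) ^+ 2
      = 3 / 10 * (u * v) ^+ 3 * (w ^+ 2 - 2 * (u * v)) by field.
  by rewrite !mulr_ge0 ?exprn_ge0 ?subr_ge0// ltW.
rewrite -subr_ge0.
have -> : (u ^+ 3)^-1 + (v ^+ 3)^-1
     + ((u^-1 + v^-1) / 2 / w ^+ 2 - 3 / 5 / w ^+ 3)
     - (u ^+ 4 + u ^+ 2 * v ^+ 2 + v ^+ 4) / (u ^+ 3 * v ^+ 3 * w)
  = ((u * v) ^+ 2 * (w * (u + v) / 2 - 3 / 5 * (u * v))
     - w ^+ 2 * (u ^+ 4 + u ^+ 2 * v ^+ 2 + v ^+ 4 - w * (u ^+ 3 + v ^+ 3)))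
    / (u ^+ 3 * v ^+ 3 * w ^+ 3).
  by field; rewrite !gt_eqF.
rewrite excess_factor//; apply: divr_ge0.
  2: by rewrite ltW// !mulr_gt0 ?exprn_gt0.
rewrite subr_ge0.
by apply: (le_trans key); apply: ler_wpM2l; [exact: sqr_ge0 | nra].
Qed.

(** * Partial sums of inverse powers *)

Lemma sqrtn_gt0 (R : realType) (n : nat) : (0 < n)%N -> 0 < Num.sqrt (n%:R : R).
Proof. by move=> n0; rewrite sqrtr_gt0 ltr0n. Qed.

Lemma powR_N12 (R : realType) (n : nat) :
  (n%:R : R) `^ (- 2^-1) = (Num.sqrt n%:R)^-1.
Proof. by rewrite powRN powR12_sqrt. Qed.

Lemma powR_N32 (R : realType) (n : nat) :
  (n%:R : R) `^ (- (3 / 2)) = (Num.sqrt n%:R ^+ 3)^-1.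
Proof.
rewrite powRN; congr (_^-1).
by rewrite mulrC powRrM powR12_sqrt// powR_mulrn// sqrtr_ge0.
Qed.

Lemma harmonic_sumS (R : realType) (s : R) (M : nat) :
  harmonic_sum s M.+1 = harmonic_sum s M + M.+1%:R `^ (- s).
Proof. by rewrite /harmonic_sum big_nat_recr. Qed.

Lemma harmonic_sum0 (R : realType) (s : R) : harmonic_sum s 0 = 0.
Proof. by rewrite /harmonic_sum big_geq. Qed.

(** Telescoping [1 / sqrt (n + 1) <= 2 (sqrt (n + 1) - sqrt n)]. *)
Lemma harmonic_sum12_le (R : realType) (M : nat) :
  harmonic_sum (2^-1 : R) M <= 2 * Num.sqrt M%:R.
Proof.
elim: M => [|M IH]; first by rewrite harmonic_sum0 sqrtr0 mulr0.
rewrite harmonic_sumS powR_N12.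
have u0 : 0 <= Num.sqrt (M%:R : R) by rewrite sqrtr_ge0.
have v0 := @sqrtn_gt0 R M.+1 isT.
have vE : Num.sqrt (M.+1%:R : R) ^+ 2 = Num.sqrt M%:R ^+ 2 + 1.
  by rewrite !sqr_sqrtr// -natr1.
move: (Num.sqrt (M%:R : R)) (Num.sqrt (M.+1%:R : R)) IH u0 v0 vE
  => u v IH u0 v0 vE.
suff : v^-1 <= 2 * (v - u) by lra.
by rewrite -(ler_pM2r v0) mulVf ?gt_eqF//; nra.
Qed.

Lemma harmonic_sum32_ge1 (R : realType) (N : nat) :
  (1 <= N)%N -> 1 <= harmonic_sum (3 / 2 : R) N.
Proof.
case: N => // N _; elim: N => [|N IH].
  by rewrite harmonic_sumS harmonic_sum0 add0r powR1.
by rewrite harmonic_sumS (le_trans IH)// lerDl powR_ge0.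
Qed.

(** * The cubic sum of the unit plateau *)

Definition plateau_interaction (R : realType) (a b : nat) : R :=
  (a%:R + b%:R) * (a%:R ^+ 2 + a%:R * b%:R + b%:R ^+ 2)
  * a%:R `^ (- (3 / 2)) * b%:R `^ (- (3 / 2)) * (a + b)%:R `^ (- (3 / 2)).

(** Grouping the pairs by [c = a + b] makes the cutoff [a + b <= N] a bound on
    the outer index, and each antidiagonal can then be estimated separately. *)
Definition plateau_cubic (R : realType) (N : nat) : R :=
  \sum_(1 <= c < N.+1) \sum_(1 <= a < c) plateau_interaction R a (c - a).

Lemma plateau_interactionE (R : realType) (a b : nat) :
  (0 < a)%N -> (0 < b)%N ->
  let u := Num.sqrt (a%:R : R) in let v := Num.sqrt (b%:R : R) in
  plateau_interaction R a b
  = (u ^+ 4 + u ^+ 2 * v ^+ 2 + v ^+ 4)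
    / (u ^+ 3 * v ^+ 3 * Num.sqrt (a + b)%:R).
Proof.
move=> a0 b0 u v; rewrite /plateau_interaction !powR_N32 -/u -/v.
have w0 : 0 < Num.sqrt ((a + b)%:R : R) by rewrite sqrtn_gt0// addn_gt0 a0.
have u0 : 0 < u by apply: sqrtn_gt0.
have v0 : 0 < v by apply: sqrtn_gt0.
have -> : (a%:R + b%:R : R) = Num.sqrt (a + b)%:R ^+ 2.
  by rewrite sqr_sqrtr// natrD.
have -> : (a%:R : R) = u ^+ 2 by rewrite sqr_sqrtr.
have -> : (b%:R : R) = v ^+ 2 by rewrite sqr_sqrtr.
by field; rewrite !gt_eqF.
Qed.

Lemma sqrt_addn_sqr (R : realType) (a b : nat) :
  Num.sqrt ((a + b)%:R : R) ^+ 2 = Num.sqrt a%:R ^+ 2 + Num.sqrt b%:R ^+ 2.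
Proof. by rewrite !sqr_sqrtr// natrD. Qed.

Lemma plateau_interaction_ge (R : realType) (a b : nat) :
  (0 < a)%N -> (0 < b)%N ->
  a%:R `^ (- (3 / 2)) + b%:R `^ (- (3 / 2)) <= plateau_interaction R a b.
Proof.
move=> a0 b0; rewrite plateau_interactionE// !powR_N32.
by rewrite excess_ge0 ?sqrtn_gt0 ?addn_gt0 ?a0// sqrt_addn_sqr.
Qed.

Lemma plateau_interaction_le (R : realType) (a b : nat) :
  (0 < a)%N -> (0 < b)%N ->
  plateau_interaction R a b <=
  a%:R `^ (- (3 / 2)) + b%:R `^ (- (3 / 2))
  + ((a%:R `^ (- 2^-1) + b%:R `^ (- 2^-1)) / 2 / (a + b)%:R
     - 3 / 5 / Num.sqrt (a + b)%:R ^+ 3).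
Proof.
move=> a0 b0; rewrite plateau_interactionE// !powR_N32 !powR_N12.
rewrite -[X in _ / X - _](@sqr_sqrtr _ (a + b)%:R)//.
by rewrite excess_le ?sqrtn_gt0 ?addn_gt0 ?a0// sqrt_addn_sqr.
Qed.

Lemma sum_diag_sym (R : realType) (f : nat -> R) (c : nat) :
  \sum_(1 <= a < c) (f a + f (c - a)%N) = 2 * \sum_(1 <= a < c) f a.
Proof.
rewrite big_split/= mulrDl !mul1r; congr (_ + _).
rewrite [RHS]big_nat_rev/=; apply: eq_bigr => i _; congr f; lia.
Qed.

Lemma harmonic_sum_pred (R : realType) (s : R) (c : nat) : (0 < c)%N ->
  \sum_(1 <= a < c) a%:R `^ (- s) = harmonic_sum s c.-1.
Proof. by case: c. Qed.

Lemma diagonal_ge (R : realType) (c : nat) : (0 < c)%N ->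
  2 * harmonic_sum (3 / 2 : R) c.-1
  <= \sum_(1 <= a < c) plateau_interaction R a (c - a).
Proof.
move=> c0; rewrite -harmonic_sum_pred// -(sum_diag_sym _ (fun n => n%:R `^ _)).
apply: ler_sum_nat => a /andP[a1 ac].
by apply: plateau_interaction_ge; lia.
Qed.

(** Summing [excess_le] gives [h / c - (3/5) (c - 1) / c^(3/2)], where
    [h <= 2 sqrt (c - 1)] is the sum of [a^(-1/2)] over [a < c].  As
    [2 sqrt (c - 1) sqrt c <= 2 c - 1], this is at most
    [(1.4 c - 0.4) / c^(3/2)], and [1.4 <= sqrt 2]. *)
Lemma diagonal_le (R : realType) (c : nat) : (1 < c)%N ->
  \sum_(1 <= a < c) plateau_interaction R a (c - a)
  <= 2 * harmonic_sum (3 / 2 : R) c.-1 + Num.sqrt 2 * (1 / Num.sqrt c%:R).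
Proof.
move=> c1; have c0 : (0 < c)%N by lia.
apply: (@le_trans _ _ (2 * harmonic_sum (3 / 2 : R) c.-1
   + (harmonic_sum (2^-1 : R) c.-1 / c%:R
      - 3 / 5 / Num.sqrt c%:R ^+ 3 * (c.-1)%:R))).
  rewrite -!harmonic_sum_pred// -(sum_diag_sym _ (fun n => n%:R `^ _)).
  have -> : \sum_(1 <= a < c) (a%:R : R) `^ (- 2^-1)
      = (\sum_(1 <= a < c) (a%:R `^ (- 2^-1) + (c - a)%:R `^ (- 2^-1))) / 2.
    by rewrite (sum_diag_sym _ (fun n => n%:R `^ _)) mulrC mulKf.
  have -> : 3 / 5 / Num.sqrt (c%:R : R) ^+ 3 * (c.-1)%:R
      = \sum_(1 <= a < c) (3 / 5 / Num.sqrt (c%:R : R) ^+ 3).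
    by rewrite sumr_const_nat subn1 mulr_natr.
  rewrite mulr_suml mulr_suml -sumrB -big_split/=.
  apply: ler_sum_nat => a /andP[a1 ac].
  have -> : (c%:R : R) = (a + (c - a))%:R by congr (_%:R); lia.
  by apply: plateau_interaction_le; lia.
rewrite lerD2l.
have h := harmonic_sum12_le R c.-1.
have w0 := sqrtn_gt0 R c c0.
have vE : Num.sqrt (c.-1%:R : R) ^+ 2 = Num.sqrt c%:R ^+ 2 - 1.
  rewrite !sqr_sqrtr//; case: c {c1 w0 h} c0 => // c _.
  by rewrite -natr1/=; ring.
have cE : (c%:R : R) = Num.sqrt c%:R ^+ 2 by rewrite sqr_sqrtr.
have c1E : (c.-1%:R : R) = Num.sqrt c.-1%:R ^+ 2 by rewrite sqr_sqrtr.
rewrite [X in _ / X - _]cE c1E vE.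
have v0 : 0 <= Num.sqrt (c.-1%:R : R) by rewrite sqrtr_ge0.
have r2 : 14 / 10 <= Num.sqrt (2 : R).
  rewrite -(@ler_pXn2r _ 2)// ?nnegrE ?sqrtr_ge0// sqr_sqrtr//; lra.
move: (Num.sqrt (c%:R : R)) (Num.sqrt (c.-1%:R : R)) (Num.sqrt (2 : R))
  (harmonic_sum (2^-1 : R) c.-1) h w0 vE v0 r2 {cE c1E}
  => w v r H h w0 vE v0 r2.
have -> : H / w ^+ 2 - 3 / 5 / w ^+ 3 * (w ^+ 2 - 1)
    = (H * w - 3 / 5 * (w ^+ 2 - 1)) / w ^+ 3.
  by field; rewrite gt_eqF.
rewrite ler_pdivrMr ?exprn_gt0//.
have -> : r * (1 / w) * w ^+ 3 = r * w ^+ 2 by field; rewrite gt_eqF.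
have Hw : H * w <= 2 * v * w by rewrite ler_wpM2r// ltW.
have vw : 2 * v * w <= 2 * w ^+ 2 - 1 by have := sqr_ge0 (w - v); nra.
have rw : 14 / 10 * w ^+ 2 <= r * w ^+ 2 by rewrite ler_wpM2r// sqr_ge0.
lra.
Qed.

(** Summation by parts.  The last sum is that of [a^(-3/2) + b^(-3/2)] over the
    triangle [a + b <= N], so this isolates in [2 A E_3] the main term of the
    cubic form. *)
Lemma harmonic_sum32_split (R : realType) (N : nat) :
  2 * N%:R * harmonic_sum (3 / 2 : R) N
  = 2 * harmonic_sum (2^-1 : R) N
    + \sum_(1 <= c < N.+1) 2 * harmonic_sum (3 / 2 : R) c.-1.
Proof.
elim: N => [|N IH]; first by rewrite !harmonic_sum0 big_geq// !mulr0 addr0.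
rewrite big_nat_recr//= !harmonic_sumS powR_N32 powR_N12.
have v0 := @sqrtn_gt0 R N.+1 isT.
have -> : 2 * N.+1%:R * (harmonic_sum (3 / 2 : R) N + Num.sqrt N.+1%:R ^- 3)
    = 2 * N%:R * harmonic_sum (3 / 2 : R) N + 2 * harmonic_sum (3 / 2 : R) N
      + 2 * (Num.sqrt N.+1%:R ^+ 2 * Num.sqrt N.+1%:R ^- 3).
  by rewrite sqr_sqrtr// -natr1; ring.
by rewrite IH; field; rewrite gt_eqF.
Qed.

(** The term [2 / sqrt N] is the missing last term of [2 h_(N-1)]. *)
Lemma plateau_gapE (R : realType) (N : nat) : (1 <= N)%N ->
  plateau_gap R N = 2 * harmonic_sum (2^-1 : R) N
    - Num.sqrt 2 * \sum_(2 <= c < N.+1) 1 / Num.sqrt c%:R.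
Proof.
case: N => // N _; rewrite /plateau_gap harmonic_sumS powR_N12 mulrDr.
by rewrite [2 / _ + _]addrC.
Qed.

(** Past its first term 1, the harmonic sum has the same terms [1 / sqrt c] as
    the subtracted sum, and [sqrt 2 <= 2]. *)
Lemma plateau_gap_gt0 (R : realType) (N : nat) : (1 <= N)%N ->
  0 < plateau_gap R N.
Proof.
move=> N1; rewrite plateau_gapE//.
have r2 : Num.sqrt (2 : R) <= 2.
  by rewrite -[leRHS]gtr0_norm// -sqrtr_sqr ler_sqrt//; lra.
have -> : harmonic_sum (2^-1 : R) N
    = 1 + \sum_(2 <= c < N.+1) 1 / Num.sqrt c%:R.
  rewrite /harmonic_sum big_ltn// powR1; congr (_ + _).
  by apply: eq_bigr => i _; rewrite powR_N12 div1r.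
have S0 : 0 <= \sum_(2 <= c < N.+1) 1 / Num.sqrt (c%:R : R).
  by apply: sumr_ge0 => i _; rewrite divr_ge0.
nra.
Qed.

Lemma plateau_cubic_ge (R : realType) (N : nat) :
  2 * N%:R * harmonic_sum (3 / 2 : R) N - 2 * harmonic_sum (2^-1 : R) N
  <= plateau_cubic R N.
Proof.
rewrite harmonic_sum32_split addrAC subrr add0r.
by apply: ler_sum_nat => c /andP[c1 _]; apply: diagonal_ge.
Qed.

Lemma plateau_cubic_le (R : realType) (N : nat) : (1 <= N)%N ->
  plateau_cubic R N <= 2 * N%:R * harmonic_sum (3 / 2 : R) N - plateau_gap R N.
Proof.
move=> N1; rewrite harmonic_sum32_split plateau_gapE//.
have -> : \sum_(1 <= c < N.+1) 2 * harmonic_sum (3 / 2 : R) c.-1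
    = \sum_(2 <= c < N.+1) 2 * harmonic_sum (3 / 2 : R) c.-1.
  by rewrite big_ltn// harmonic_sum0 mulr0 add0r.
have -> : plateau_cubic R N
    = \sum_(2 <= c < N.+1) \sum_(1 <= a < c) plateau_interaction R a (c - a).
  by rewrite /plateau_cubic big_ltn// [X in X + _]big_geq// add0r.
rewrite [leRHS](_ : _ = \sum_(2 <= c < N.+1)
    (2 * harmonic_sum (3 / 2 : R) c.-1 + Num.sqrt 2 * (1 / Num.sqrt c%:R))).
  by apply: ler_sum_nat => c /andP[c1 _]; apply: diagonal_le.
by rewrite big_split/= -[X in _ = _ + X]mulr_sumr; ring.
Qed.

(** * Series of extended reals and dilation *)

Section Series.
Context {R : realType}.
Implicit Types x : nat -> R.

Lemma eseries_finite_support (f : nat -> \bar R) (M : nat) :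
  (forall n, (M < n)%N -> f n = 0%E) ->
  (\sum_(1 <= n <oo) f n = \sum_(1 <= n < M.+1) f n)%E.
Proof.
move=> f0; apply: lim_near_cst => //.
near=> n; have Mn : (M < n)%N by near: n; exact: nbhs_infty_gt.
rewrite (@big_cat_nat _ _ _ M.+1)//= [X in (_ + X)%E](_ : _ = 0%E) ?adde0//.
by rewrite big_nat big1// => i /andP[Mi _]; apply: f0.
Unshelve. all: end_near. Qed.

Lemma nneseries_dilate (f : nat -> \bar R) (q : nat) : (1 <= q)%N ->
  (forall n, 0 <= f n)%E ->
  (\sum_(1 <= k <oo) (if (q %| k)%N then f (k %/ q)%N else 0)
   = \sum_(1 <= n <oo) f n)%E.
Proof.
move=> q1 f0.
rewrite eseries_cond -eseries_mkcondr nneseries_esum//.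
rewrite [RHS]eseries_cond nneseries_esum//.
rewrite (reindex_esum [set n | (0 < n)%N] _ (muln q)).
  by apply: eq_esum => n _ /=; rewrite mulKn.
split.
- by move=> n /= n1; rewrite muln_gt0 q1 n1 dvdn_mulr.
- by move=> m n _ _ /eqP; rewrite eqn_pmul2l// => /eqP.
- move=> k /= /andP[k1 /dvdnP[n kE]]; exists n => /=; lia.
Qed.

Lemma plateau_ge0 (N : nat) (lambda : R) (n : nat) :
  0 <= lambda -> 0 <= plateau N lambda n.
Proof.
by move=> l0; rewrite /plateau; case: ifP => // _; rewrite mulr_ge0// powR_ge0.
Qed.

Lemma total_mass_dilate q x : (1 <= q)%N -> (forall n, 0 <= x n) ->
  total_mass (dilate q x) = total_mass x.
Proof.
move=> q1 x0; rewrite -[RHS](nneseries_dilate _ q)//.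
by apply: eq_eseriesr => k _; rewrite /dilate; case: ifP.
Qed.

Lemma energy3_dilate q x : (1 <= q)%N -> (forall n, 0 <= x n) ->
  energy3 (dilate q x) = ((q%:R ^+ 3)%:E * energy3 x)%E.
Proof.
move=> q1 x0; rewrite -nneseriesZl; last first.
  by move=> n _; rewrite lee_fin mulr_ge0 ?exprn_ge0.
rewrite -[RHS](nneseries_dilate _ q)//; last first.
  by move=> n; rewrite -EFinM lee_fin !mulr_ge0 ?exprn_ge0.
apply: eq_eseriesr => k _; rewrite /dilate; case: ifP => [/dvdnP[n ->]|_].
  by rewrite mulnK// -EFinM; congr (_%:E); rewrite natrM; ring.
by rewrite expr0n mulr0.
Qed.

Lemma cubic_term_ge0 x a b : (forall n, 0 <= x n) ->
  0 <= (a%:R + b%:R) * (a%:R ^+ 2 + a%:R * b%:R + b%:R ^+ 2)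
       * x a * x b * x (a + b)%N.
Proof. by move=> x0; rewrite !mulr_ge0// ?addr_ge0// ?exprn_ge0// mulr_ge0. Qed.

(** A term survives only if [q] divides both [a] and [b], hence [a + b], and the
    kernel is homogeneous of degree 3; so the reindexing of [nneseries_dilate]
    applies to the inner and then to the outer series. *)
Lemma cubic_form_dilate q x : (1 <= q)%N -> (forall n, 0 <= x n) ->
  cubic_form (dilate q x) = ((q%:R ^+ 3)%:E * cubic_form x)%E.
Proof.
move=> q1 x0.
have t0 a b := cubic_term_ge0 x a b x0.
rewrite -nneseriesZl; last first.
  by move=> a _; apply: nneseries_ge0 => b _ _; rewrite lee_fin.
rewrite -[RHS](nneseries_dilate _ q)//; last first.
  move=> a; rewrite mule_ge0 ?lee_fin ?exprn_ge0//.
  by apply: nneseries_ge0 => b _ _; rewrite lee_fin.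
apply: eq_eseriesr => k _; case: ifP => [/dvdnP[a ->]|qk]; last first.
  by apply: eseries0 => b _ _; rewrite /dilate qk mulr0 !mul0r.
rewrite mulnK// -nneseriesZl; last by move=> b _; rewrite lee_fin.
rewrite -[RHS](nneseries_dilate _ q)//; last first.
  by move=> b; rewrite -EFinM lee_fin mulr_ge0 ?exprn_ge0.
apply: eq_eseriesr => l _; case: ifP => [/dvdnP[b ->]|ql]; last first.
  by rewrite /dilate ql mulr0 mul0r.
rewrite /dilate -mulnDl !dvdn_mull// !mulnK// -EFinM; congr (_%:E).
by rewrite !natrM; ring.
Qed.

End Series.

(** * The three functionals on plateaux *)

Lemma sum_triangle (V : zmodType) (F : nat -> nat -> V) (N : nat) :
  \sum_(1 <= a < N.+1) \sum_(1 <= b < (N - a).+1) F a b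
  = \sum_(1 <= c < N.+1) \sum_(1 <= a < c) F a (c - a)%N.
Proof.
elim: N => [|N IH]; first by rewrite !big_geq.
rewrite [RHS]big_nat_recr//= -IH big_nat_recr//= subnn.
rewrite [X in _ + X]big_geq// addr0.
rewrite -big_split/=; apply: eq_big_nat => a /andP[a1 aN].
by rewrite subSn// big_nat_recr.
Qed.

Section Plateau.
Context {R : realType}.

Lemma total_mass_plateau (N : nat) (lambda : R) :
  total_mass (plateau N lambda) = (lambda * harmonic_sum (3 / 2) N)%:E.
Proof.
rewrite /total_mass (eseries_finite_support _ N); last first.
  by move=> n Nn; rewrite /plateau [(n <= N)%N]leqNgt Nn andbF.
rewrite sumEFin; congr (_%:E); rewrite /harmonic_sum mulr_sumr.
by apply: eq_big_nat => n; rewrite ltnS /plateau => ->.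
Qed.

Lemma energy3_plateau (N : nat) (lambda : R) :
  energy3 (plateau N lambda) = (lambda ^+ 2 * N%:R)%:E.
Proof.
rewrite /energy3 (eseries_finite_support _ N); last first.
  by move=> n Nn; rewrite /plateau [(n <= N)%N]leqNgt Nn andbF expr0n mulr0.
rewrite sumEFin; congr (_%:E).
rewrite (eq_big_nat _ _ (F2 := fun=> lambda ^+ 2)).
  by rewrite sumr_const_nat subn1 mulr_natr.
move=> n /andP[n1]; rewrite ltnS /plateau => nN; rewrite n1 nN powR_N32 /=.
have n0 := @sqrtn_gt0 R n n1.
rewrite -[X in X ^+ 3 * _](@sqr_sqrtr _ n%:R)//.
by field; rewrite gt_eqF.
Qed.

Lemma cubic_form_plateau (N : nat) (lambda : R) :
  cubic_form (plateau N lambda) = (lambda ^+ 3 * plateau_cubic R N)%:E.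
Proof.
rewrite /cubic_form (eseries_finite_support _ N); last first.
  move=> a Na; apply: eseries0 => b _ _.
  by rewrite {1}/plateau [(a <= N)%N]leqNgt Na andbF mulr0 !mul0r.
rewrite /plateau_cubic -sum_triangle mulr_sumr -sumEFin.
apply: eq_big_nat => a /andP[a1 aN].
rewrite (eseries_finite_support _ (N - a)); last first.
  move=> b Nb; rewrite {3}/plateau; case: ifP; last by rewrite mulr0.
  by move=> /andP[_]; lia.
rewrite sumEFin mulr_sumr; congr (_%:E); apply: eq_big_nat => b /andP[b1 bN].
rewrite /plateau /plateau_interaction !ifT; [|lia..].
by ring.
Qed.

End Plateau.

(** * The ratio, its limit and the deficit *)

(** The ratio of the cubic form to [A E_3]; the powers of [lambda] cancel. *)
Definition plateau_ratio (R : realType) (N : nat) : R :=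
  plateau_cubic R N / (N%:R * harmonic_sum (3 / 2) N).

Section Ratio.
Context {R : realType}.

Lemma plateau_denom_gt0 (N : nat) : (1 <= N)%N ->
  0 < N%:R * harmonic_sum (3 / 2 : R) N.
Proof.
move=> N1; rewrite mulr_gt0 ?ltr0n//.
exact: lt_le_trans (harmonic_sum32_ge1 R N N1).
Qed.

Lemma plateau_ratio_lt2 (N : nat) : (1 <= N)%N -> plateau_ratio R N < 2.
Proof.
move=> N1; rewrite ltr_pdivrMr ?plateau_denom_gt0// mulrA.
apply: le_lt_trans (plateau_cubic_le R N N1) _.
by rewrite ltrBlDr ltrDl plateau_gap_gt0.
Qed.

Lemma plateau_ratio_ge (N : nat) : (1 <= N)%N ->
  2 - 4 * Num.sqrt N%:R^-1 <= plateau_ratio R N.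
Proof.
move=> N1; rewrite ler_pdivlMr ?plateau_denom_gt0//.
apply: le_trans (plateau_cubic_ge R N).
have h := harmonic_sum12_le R N; have H1 := harmonic_sum32_ge1 R N N1.
rewrite sqrtrV//; have w0 := sqrtn_gt0 R N N1.
rewrite mulrBl mulrA lerD2l lerN2.
have -> : 4 * (Num.sqrt N%:R)^-1 * (N%:R * harmonic_sum (3 / 2 : R) N)
    = 4 * Num.sqrt N%:R * harmonic_sum (3 / 2 : R) N.
  by rewrite -[X in _ * (X * _)](@sqr_sqrtr _ N%:R)//; field; rewrite gt_eqF.
nra.
Qed.

Lemma cvg_plateau_ratio : plateau_ratio R N @[N --> \oo] --> (2 : R).
Proof.
apply: (@squeeze_cvgr _ _ _ _ (fun N => 2 - 4 * Num.sqrt N%:R^-1) (cst 2)).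
- near=> N.
  have N1 : (1 <= N)%N by near: N; exact: nbhs_infty_ge.
  by rewrite plateau_ratio_ge//= ltW// plateau_ratio_lt2.
- rewrite -[X in _ --> X]subr0 -[X in _ --> _ - X](mulr0 4).
  apply: cvgB; first exact: cvg_cst.
  apply: cvgM; first exact: cvg_cst.
  rewrite -(@cvg_shiftS _ (fun N => Num.sqrt N%:R^-1)).
  have := continuous_cvg _ (@sqrt_continuous R 0) (@cvg_harmonic R).
  rewrite sqrtr0; apply.
- exact: cvg_cst.
Unshelve. all: end_near. Qed.

Local Open Scope ereal_scope.

Lemma plateau_ratioE (N : nat) (lambda : R) : (1 <= N)%N -> (0 < lambda)%R ->
  cubic_form (plateau N lambda)
    / (total_mass (plateau N lambda) * energy3 (plateau N lambda))
  = (plateau_ratio R N)%:E.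
Proof.
move=> N1 l0; have d0 := plateau_denom_gt0 N N1.
rewrite cubic_form_plateau total_mass_plateau energy3_plateau -EFinM.
have E : (lambda * harmonic_sum (3 / 2) N * (lambda ^+ 2 * N%:R)
    = lambda ^+ 3 * (N%:R * harmonic_sum (3 / 2) N))%R by ring.
rewrite E inver mulf_eq0 expf_eq0/= (gt_eqF l0) (gt_eqF d0)/= -EFinM.
congr (_%:E); rewrite /plateau_ratio invfM mulrACA mulfV ?mul1r//.
by rewrite expf_neq0// gt_eqF.
Qed.

Lemma cvg_eventually_plateau_ratio (f : nat -> \bar R) :
  (forall N, (1 <= N)%N -> f N = (plateau_ratio R N)%:E) ->
  f N @[N --> \oo] --> 2%:E.
Proof.
move=> fE; apply: cvg_trans (near_eq_cvg _)
  (cvg_EFin (f := EFin \o plateau_ratio R) _ _).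
- by near=> N; rewrite fE//; near: N; exact: nbhs_infty_ge.
- exact: nearW.
- exact: cvg_plateau_ratio.
Unshelve. all: end_near. Qed.

Lemma plateau_deficit (N : nat) (lambda : R) : (1 <= N)%N -> (0 <= lambda)%R ->
  (lambda ^+ 3 * plateau_gap R N)%:E
    <= 2%:E * total_mass (plateau N lambda) * energy3 (plateau N lambda)
       - cubic_form (plateau N lambda).
Proof.
move=> N1 l0.
rewrite cubic_form_plateau total_mass_plateau energy3_plateau -!EFinM -EFinB.
rewrite lee_fin.
have -> : (2 * (lambda * harmonic_sum (3 / 2) N) * (lambda ^+ 2 * N%:R)
    - lambda ^+ 3 * plateau_cubic R N
  = lambda ^+ 3 * (2 * N%:R * harmonic_sum (3 / 2) N - plateau_cubic R N))%R.
  by ring.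
by rewrite ler_wpM2l ?exprn_ge0// lerBrDr addrC -lerBrDr plateau_cubic_le.
Qed.

Lemma cubic_form_plateau_lt (N : nat) (lambda : R) :
  (1 <= N)%N -> (0 < lambda)%R ->
  cubic_form (plateau N lambda)
    < 2%:E * total_mass (plateau N lambda) * energy3 (plateau N lambda).
Proof.
move=> N1 l0; have := plateau_deficit N lambda N1 (ltW l0).
rewrite cubic_form_plateau total_mass_plateau energy3_plateau -!EFinM -EFinB.
rewrite lee_fin lte_fin -subr_gt0; apply: lt_le_trans.
by rewrite mulr_gt0 ?exprn_gt0 ?plateau_gap_gt0.
Qed.

(** * Sharpness and dilated plateaux *)

Lemma plateau_constant_ge2 (K : R) :
  (forall N, (1 <= N)%N -> (plateau_ratio R N <= K)%R) -> (2 <= K)%R.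
Proof.
move=> CK; rewrite leNgt; apply/negP => K2.
have [M _ HM] := cvgr_gt _ cvg_plateau_ratio _ K2.
by have := HM M.+1 (leqnSn M); rewrite /= ltNge CK.
Qed.

Lemma plateau_bound_mono (K : R) (N : nat) (lambda : R) :
  (2 <= K)%R -> (1 <= N)%N -> (0 <= lambda)%R ->
  cubic_form (plateau N lambda)
    <= K%:E * total_mass (plateau N lambda) * energy3 (plateau N lambda).
Proof.
move=> K2 N1 l0; have := plateau_deficit N lambda N1 l0.
rewrite cubic_form_plateau total_mass_plateau energy3_plateau -!EFinM -EFinB.
rewrite !lee_fin => D.
have g0 : (0 <= lambda ^+ 3 * plateau_gap R N)%R.
  by rewrite mulr_ge0 ?exprn_ge0// ltW// plateau_gap_gt0.
have A0 : (0 <= lambda * harmonic_sum (3 / 2) N * (lambda ^+ 2 * N%:R))%R.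
  rewrite !mulr_ge0 ?exprn_ge0//.
  exact: le_trans ler01 (harmonic_sum32_ge1 R N N1).
have : (0 <= (K - 2)
    * (lambda * harmonic_sum (3 / 2) N * (lambda ^+ 2 * N%:R)))%R.
  by rewrite mulr_ge0// subr_ge0.
by move: A0 D g0; rewrite -!mulrA; lra.
Qed.

(** The deficit is multiplied by [q^3 >= 1], which can only increase it since it
    is nonnegative. *)
Lemma dilate_plateau_deficit (q N : nat) (lambda : R) :
  (1 <= q)%N -> (1 <= N)%N -> (0 <= lambda)%R ->
  (lambda ^+ 3 * plateau_gap R N)%:E
    <= 2%:E * total_mass (dilate q (plateau N lambda))
       * energy3 (dilate q (plateau N lambda))
       - cubic_form (dilate q (plateau N lambda)).
Proof.
move=> q1 N1 l0; have p0 n := plateau_ge0 N lambda n l0.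
rewrite cubic_form_dilate ?total_mass_dilate ?energy3_dilate//.
apply: le_trans (plateau_deficit N lambda N1 l0) _.
have := plateau_bound_mono 2 N lambda (lexx _) N1 l0.
rewrite cubic_form_plateau total_mass_plateau energy3_plateau.
rewrite -!EFinM -!EFinB !lee_fin => D0.
have Q1 : (1 <= q%:R ^+ 3 :> R)%R by rewrite exprn_ege1// ler1n.
nra.
Qed.

Lemma dilate_plateau_ratioE (q N : nat) (lambda : R) :
  (1 <= q)%N -> (1 <= N)%N -> (0 < lambda)%R ->
  cubic_form (dilate q (plateau N lambda))
    / (total_mass (dilate q (plateau N lambda))
       * energy3 (dilate q (plateau N lambda)))
  = (plateau_ratio R N)%:E.
Proof.
move=> q1 N1 l0; have p0 n := plateau_ge0 N lambda n (ltW l0).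
rewrite -(plateau_ratioE N lambda)//.
rewrite cubic_form_dilate ?total_mass_dilate ?energy3_dilate// muleCA.
rewrite cubic_form_plateau total_mass_plateau energy3_plateau -!EFinM.
have Q0 : (q%:R ^+ 3 != 0 :> R)%R by rewrite expf_neq0// pnatr_eq0 -lt0n.
have d0 : (lambda * harmonic_sum (3 / 2) N * (lambda ^+ 2 * N%:R) != 0)%R.
  rewrite mulrACA -exprS mulf_neq0 ?expf_neq0 ?(gt_eqF l0)//.
  by rewrite mulrC gt_eqF// plateau_denom_gt0.
rewrite !inver mulf_eq0 (negbTE Q0) (negbTE d0)/= -!EFinM.
by rewrite -mulf_div mulfV ?mul1r.
Qed.

(** By induction on the bound [M]: once [N k >= M], the value [N k = M] is
    excluded as soon as the ratio exceeds its value at [M], which is below 2. *)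
Lemma plateau_ratio_cvg2_cutoff (N : nat -> nat) :
  (forall k, (1 <= N k)%N) ->
  plateau_ratio R (N k) @[k --> \oo] --> (2 : R)%R ->
  N k @[k --> \oo] --> \oo.
Proof.
move=> N1 cvg2; apply/cvgnyPge; elim=> [|M IH]; first exact: nearW.
have [->|M1] := posnP M; first exact: nearW.
have M2 : \forall k \near \oo, (plateau_ratio R M < plateau_ratio R (N k))%R.
  by apply: cvgr_gt cvg2 _ _; exact: plateau_ratio_lt2.
near=> k.
have Mk : (M <= N k)%N by near: k.
have : (plateau_ratio R M < plateau_ratio R (N k))%R by near: k.
by move: Mk; rewrite leq_eqVlt => /predU1P[<-|//]; rewrite ltxx.
Unshelve. all: end_near. Qed.

End Ratio.

Local Open Scope ereal_scope.

Theorem proposition3p19 (R : realType) :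
  (* the plateaux supported on {1, ..., N} *)
  ((forall (N : nat) (lambda : R), (1 <= N)%N -> (0 < lambda)%R ->
      cubic_form (plateau N lambda)
        < 2%:E * total_mass (plateau N lambda) * energy3 (plateau N lambda)) /\
   (forall (N : nat) (lambda : R), (1 <= N)%N -> (0 <= lambda)%R ->
      (lambda ^+ 3 * plateau_gap R N)%:E
        <= 2%:E * total_mass (plateau N lambda) * energy3 (plateau N lambda)
           - cubic_form (plateau N lambda)) /\
   (forall (N : nat) (lambda : R), (1 <= N)%N -> (0 < lambda)%R ->
      (0 < lambda ^+ 3 * plateau_gap R N)%R) /\
   (forall lambda : R, (0 < lambda)%R ->
      cubic_form (plateau N lambda)
        / (total_mass (plateau N lambda) * energy3 (plateau N lambda))
        @[N --> \oo] --> 2%:E)) /\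
  (* the dilated plateaux supported on {q, 2q, ..., Nq} *)
  (forall q : nat, (1 <= q)%N ->
   (forall (N : nat) (lambda : R), (1 <= N)%N -> (0 < lambda)%R ->
      cubic_form (dilate q (plateau N lambda))
        < 2%:E * total_mass (dilate q (plateau N lambda))
          * energy3 (dilate q (plateau N lambda))) /\
   (forall (N : nat) (lambda : R), (1 <= N)%N -> (0 <= lambda)%R ->
      (lambda ^+ 3 * plateau_gap R N)%:E
        <= 2%:E * total_mass (dilate q (plateau N lambda))
             * energy3 (dilate q (plateau N lambda))
           - cubic_form (dilate q (plateau N lambda))) /\
   (forall lambda : R, (0 < lambda)%R ->
      cubic_form (dilate q (plateau N lambda))
        / (total_mass (dilate q (plateau N lambda))
           * energy3 (dilate q (plateau N lambda)))
        @[N --> \oo] --> 2%:E)) /\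
  (* the constants admissible on all plateaux are exactly those >= 2 *)
  (forall K : R,
     (forall (N : nat) (lambda : R), (1 <= N)%N -> (0 <= lambda)%R ->
        cubic_form (plateau N lambda)
          <= K%:E * total_mass (plateau N lambda) * energy3 (plateau N lambda))
     <-> (2 <= K)%R) /\
  (* no nonzero finite plateau attains equality *)
  (forall (N : nat) (lambda : R), (1 <= N)%N -> (0 < lambda)%R ->
     cubic_form (plateau N lambda)
       <> 2%:E * total_mass (plateau N lambda) * energy3 (plateau N lambda)) /\
  (* plateaux can approach equality only if their cutoffs tend to infinity *)
  (forall (N : nat -> nat) (lambda : nat -> R),
     (forall k, (1 <= N k)%N) -> (forall k, (0 < lambda k)%R) ->
     cubic_form (plateau (N k) (lambda k))
       / (total_mass (plateau (N k) (lambda k))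
          * energy3 (plateau (N k) (lambda k)))
       @[k --> \oo] --> 2%:E ->
     N k @[k --> \oo] --> \oo).
Proof.
have p0 N (l : R) : (0 < l)%R -> forall n, (0 <= plateau N l n)%R.
  by move=> l0 n; exact: plateau_ge0 (ltW l0).
split; [split; [|split; [|split]]|split; [|split; [|split]]].
- exact: cubic_form_plateau_lt.
- exact: plateau_deficit.
- by move=> N l N1 l0; rewrite mulr_gt0 ?exprn_gt0 ?plateau_gap_gt0.
- move=> l l0; apply: cvg_eventually_plateau_ratio => N N1.
  exact: plateau_ratioE.
- move=> q q1; have Q0 : (0 < q%:R ^+ 3 :> R)%R by rewrite exprn_gt0 ?ltr0n.
  split; [|split].
  + move=> N l N1 l0.
    rewrite cubic_form_dilate ?total_mass_dilate ?energy3_dilate//;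
      [|exact: p0..].
    by rewrite muleCA lte_pmul2l ?lte_fin// cubic_form_plateau_lt.
  + by move=> N l; exact: dilate_plateau_deficit.
  + move=> l l0; apply: cvg_eventually_plateau_ratio => N N1.
    exact: dilate_plateau_ratioE.
- move=> K; split=> [CK|K2 N l N1 l0]; last exact: plateau_bound_mono.
  apply: plateau_constant_ge2 => N N1; have := CK N 1%R N1 ler01.
  rewrite cubic_form_plateau total_mass_plateau energy3_plateau.
  rewrite -!EFinM lee_fin !expr1n !mul1r => CN.
  by rewrite ler_pdivrMr ?plateau_denom_gt0// [X in (_ <= _ * X)%R]mulrC mulrA.
- by move=> N l N1 l0 E; have := cubic_form_plateau_lt N l N1 l0; rewrite E ltxx.
- move=> N l N1 l0 cvg2; apply: plateau_ratio_cvg2_cutoff => //.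
  apply: cvg_trans (fine_cvg cvg2); apply: near_eq_cvg; apply: nearW => k /=.
  by rewrite plateau_ratioE.
Qed.
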